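(* Let $G,F$ be finite groups, $G$ acting transitively on finite sets $X$ and $Z$, and $F$ acting transitively on a finite set $Y$; let $F\wr G=F^X\rtimes G$ act on $Y^X\times Z$ by $(f,g)(\varphi,z)=((f,g)\varphi,gz)$, $[(f,g)\varphi](x)=f(x)\varphi(g^{-1}x)$. Let $\sigma=\bigotimes_{x\in X}\sigma_x$ be an irreducible representation of $F^X$ on $\bigotimes_{x\in X}V_{\sigma_x}$ such that each $\sigma_x$ occurs in the permutation representation $L(Y)$ of $F$, let $I=\{g\in G:\sigma_{gx}\sim\sigma_x\ \forall x\in X\}$, and let $(\eta,U)$ be an irreducible representation of $I$. Then the map $$\mathrm{Hom}_I(U,L(Z\times J))\longrightarrow\mathrm{Hom}_{F\wr G}\left(\mathrm{Ind}_{F\wr I}^{F\wr G}\Bigl[\Bigl(\bigotimes_{x\in X}V_{\sigma_x}\Bigr)\otimes U\Bigr],\,L(Y^X\times Z)\right),\qquad \mathcal{T}\longmapsto\stackrel{\diamond}{\widehat{\mathcal{T}}},$$ is a linear isometric isomorphism.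
   Context: All representations are unitary. $L(W)$ denotes complex functions on a finite set $W$ with $\langle f_1,f_2\rangle=\sum f_1\overline{f_2}$ and the permutation action when a group acts. Spaces $\mathrm{Hom}(\cdot,\cdot)$ carry the Hilbert--Schmidt inner product $\langle S,T\rangle=\sum_k\langle Su_k,Tu_k\rangle$, $(u_k)$ an orthonormal basis of the domain. The multiplication in $F\wr G$ is $(f,g)(f_1,g_1)=(f\cdot gf_1,gg_1)$ with $(gf_1)(x)=f_1(g^{-1}x)$. Equivalent $\sigma_x$'s are taken to be equal: there is a partition $X=\coprod_{i=1}^n\Omega_i$ and pairwise inequivalent irreducible $F$-representations $\sigma_1,\dots,\sigma_n$, with $\sigma_i$ on a space $V_i$, such that $\sigma_x=\sigma_i$, $V_{\sigma_x}=V_i$ for $x\in\Omega_i$; then $I=\{g\in G:g\Omega_i=\Omega_i\ \forall i\}$. The group $F\wr I=F^X\rtimes I$ acts on $\bigl(\bigotimes_xV_{\sigma_x}\bigr)\otimes U$ by $\widetilde\sigma\otimes\overline\eta$, where $\widetilde\sigma(f,g)\bigl(\bigotimes_xv_x\bigr)=\bigotimes_x\sigma_x(f(x))v_{g^{-1}x}$ and $\overline\eta(f,g)u=\eta(g)u$. Let $m_i$ be the multiplicity of $\sigma_i$ in $L(Y)$. For $x\in\Omega_i$ fix an orthonormal basis $T_{x,1},\dots,T_{x,m_i}$ of $\mathrm{Hom}_F(V_{\sigma_x},L(Y))$, with $T_{x,h}$ the same for all $x\in\Omega_i$. $J$ is the set of functions $j:X\to\mathbb{N}$ with $j(x)\in\{1,\dots,m_i\}$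 for $x\in\Omega_i$; $I$ acts on it by $(gj)(x)=j(g^{-1}x)$, and $I$ acts on $Z\times J$ diagonally. For $j\in J$, $T_j=\bigotimes_{x\in X}T_{x,j(x)}:\bigotimes_xV_{\sigma_x}\to L(Y^X)$, where for $\psi_x\in L(Y)$ one sets $\bigl(\bigotimes_x\psi_x\bigr)(\varphi)=\prod_x\psi_x(\varphi(x))$. For $\mathcal{T}\in\mathrm{Hom}_I(U,L(Z\times J))$, $\widehat{\mathcal{T}}\in\mathrm{Hom}_{F\wr I}\bigl((\bigotimes_xV_{\sigma_x})\otimes U,L(Y^X\times Z)\bigr)$ is defined by $[\widehat{\mathcal{T}}(v\otimes u)](\varphi,z)=\sum_{j\in J}(\mathcal{T}u)(z,j)\cdot(T_jv)(\varphi)$. The map $L\mapsto\stackrel{\diamond}{L}$: let $\mathcal{H}\le\mathcal{G}$ be finite groups, $\mathcal{G}$ acting transitively on a finite set $\mathcal{X}$, $W$ an $\mathcal{H}$-representation, $\mathcal{G}=\coprod_{s\in\mathcal{S}}s\mathcal{H}$ with $1\in\mathcal{S}$, $\tau=\mathrm{Ind}_{\mathcal{H}}^{\mathcal{G}}W$, whose vectors are uniquely written $\sum_{s\in\mathcal{S}}\tau(s)w_s$, $w_s\in W$. For $L\in\mathrm{Hom}_{\mathcal{H}}(W,\mathrm{Res}_{\mathcal{H}}^{\mathcal{G}}L(\mathcal{X}))$ set $\bigl(\stackrel{\diamond}{L}\sum_s\tau(s)w_s\bigr)(x)=\frac{1}{\sqrt{|\mathcal{S}|}}\sum_{s\in\mathcal{S}}(Lw_s)(s^{-1}x)$.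 Here it is applied with $\mathcal{G}=F\wr G$, $\mathcal{H}=F\wr I$, $\mathcal{X}=Y^X\times Z$. The induced space carries the inner product $\bigl\langle\sum_s\tau(s)w_s,\sum_s\tau(s)w'_s\bigr\rangle=\sum_s\langle w_s,w'_s\rangle$. *)

(* Defs.v *)
From HB Require Import structures.
From mathcomp Require Import all_boot all_order all_fingroup all_algebra.
From mathcomp Require Import boolp classical_sets functions.

Set Implicit Arguments.
Unset Strict Implicit.
Unset Printing Implicit Defensive.

Import GRing.Theory Num.Theory.

Local Open Scope group_scope.
Local Open Scope ring_scope.

(* Left actions; mathcomp's {action gT &-> T} are right actions. *)
Record laction (gT : finGroupType) (T : Type) := Laction {
  lact :> gT -> T -> T;
  lact1 : forall x, lact 1%g x = x;
  lactM : forall g h x, lact (g * h)%g x = lact g (lact h x) }.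

Definition ltransitive (gT : finGroupType) (T : Type) (a : laction gT T) : Prop :=
  exists x, forall y, exists g, y = a g x.

Definition wreath (fT gT : finGroupType) (X : finType) (a : laction gT X) : Type :=
  ({ffun X -> fT} * gT)%type.
Arguments wreath fT {gT X} a.

HB.instance Definition _ (fT gT : finGroupType) (X : finType) (a : laction gT X) :=
  Finite.copy (wreath fT a) ({ffun X -> fT} * gT)%type.

Definition wr_mul (fT gT : finGroupType) (X : finType) (a : laction gT X)
    (p q : wreath fT a) : wreath fT a :=
  ([ffun x => (p.1 x * q.1 (a (p.2^-1)%g x))%g], (p.2 * q.2)%g).

Definition wr_one (fT gT : finGroupType) (X : finType) (a : laction gT X) :
    wreath fT a :=
  ([ffun=> 1%g], 1%g).
Arguments wr_one fT {gT X} a.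

Definition wr_inv (fT gT : finGroupType) (X : finType) (a : laction gT X)
    (p : wreath fT a) : wreath fT a :=
  ([ffun x => (p.1 (a p.2 x))^-1%g], (p.2^-1)%g).

Lemma wr_mulA (fT gT : finGroupType) (X : finType) (a : laction gT X) :
  associative (@wr_mul fT gT X a).
Proof.
move=> [f g] [f1 g1] [f2 g2]; congr (_, _); last exact: mulgA.
by apply/ffunP => x; rewrite !ffunE /= invMg lactM mulgA.
Qed.

Lemma wr_mul1 (fT gT : finGroupType) (X : finType) (a : laction gT X) :
  left_id (wr_one fT a) (@wr_mul fT gT X a).
Proof.
move=> [f g]; congr (_, _); last exact: mul1g.
by apply/ffunP => x; rewrite !ffunE /= invg1 lact1 mul1g.
Qed.

Lemma wr_mulV (fT gT : finGroupType) (X : finType) (a : laction gT X) :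
  left_inverse (wr_one fT a) (@wr_inv fT gT X a) (@wr_mul fT gT X a).
Proof.
move=> [f g]; congr (_, _); last exact: mulVg.
by apply/ffunP => x; rewrite !ffunE /= invgK mulVg.
Qed.

HB.instance Definition _ (fT gT : finGroupType) (X : finType) (a : laction gT X) :=
  Finite_isGroup.Build (wreath fT a) (@wr_mulA fT gT X a) (@wr_mul1 fT gT X a)
    (@wr_mulV fT gT X a).

Definition wr_act (fT gT : finGroupType) (X Y Z : finType) (aX : laction gT X)
    (aY : laction fT Y) (aZ : laction gT Z)
    (p : wreath fT aX) (w : {ffun X -> Y} * Z) : {ffun X -> Y} * Z :=
  ([ffun x => aY (p.1 x) (w.1 (aX (p.2^-1)%g x))], aZ p.2 w.2).

Definition wr_sub (fT gT : finGroupType) (X : finType) (a : laction gT X)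
    (I : {set gT}) : {set wreath fT a} :=
  [set p : wreath fT a | p.2 \in I].

(* A representation of a subset H of gT (in practice a subgroup) is a function
   on all of gT, whose values outside H are irrelevant. *)
Definition unitary_rep (C : numClosedFieldType) (gT : finGroupType) (H : {set gT})
    (V : vectType C) (dotV : V -> V -> C) (rho : gT -> 'End(V)) : Prop :=
  [/\ forall v, rho 1%g v = v,
      {in H &, forall g h v, rho (g * h)%g v = rho g (rho h v)}
    & {in H, forall g v w, dotV (rho g v) (rho g w) = dotV v w}].

Definition irreducible_rep (C : numClosedFieldType) (gT : finGroupType)
    (H : {set gT}) (V : vectType C) (rho : gT -> 'End(V)) : Prop :=
  {:V}%VS != 0%VS /\
  forall W : {vspace V}, {in H, forall g, (rho g @: W <= W)%VS} ->
    W = 0%VS \/ W = {:V}%VS.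

Definition intertwiners (C : numClosedFieldType) (gT : finGroupType) (H : {set gT})
    (V W : vectType C) (rho : gT -> 'End(V)) (tau : gT -> 'End(W)) :
    {vspace 'Hom(V, W)} :=
  (\bigcap_(g in H)
     lker (linfun (fun T : 'Hom(V, W) => (T \o rho g)%VF - (tau g \o T)%VF)))%VS.

Lemma linfunE (C : numClosedFieldType) (V W : vectType C) (f : V -> W) :
  linear f -> linfun f =1 f.
Proof.
move=> linf v; pose m := GRing.isLinear.Build _ _ _ _ f linf.
by pose g : {linear V -> W} := HB.pack f m; exact: (lfunE g v).
Qed.

Lemma intertwinersP (C : numClosedFieldType) (gT : finGroupType) (H : {set gT})
    (V W : vectType C) (rho : gT -> 'End(V)) (tau : gT -> 'End(W))
    (T : 'Hom(V, W)) :
  T \in intertwiners H rho tau <->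
  {in H, forall g v, T (rho g v) = tau g (T v)}.
Proof.
have linP g : linear (fun T : 'Hom(V, W) => (T \o rho g)%VF - (tau g \o T)%VF).
  move=> a S S'; apply/lfunP => v.
  rewrite !(add_lfunE, scale_lfunE, opp_lfunE, comp_lfunE) linearD linearZ /=.
  by rewrite scalerBr opprD addrACA.
rewrite /intertwiners; split=> [/subv_bigcapP TH g Hg v | TH].
  have := TH g Hg; rewrite -memvE memv_ker linfunE // subr_eq0.
  by move=> /eqP/lfunP/(_ v); rewrite !comp_lfunE.
apply/subv_bigcapP => g Hg; rewrite -memvE memv_ker linfunE // subr_eq0.
by apply/eqP/lfunP => v; rewrite !comp_lfunE TH.
Qed.

Definition equivalent_rep (C : numClosedFieldType) (gT : finGroupType)
    (H : {set gT}) (V W : vectType C) (rho : gT -> 'End(V)) (tau : gT -> 'End(W)) :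
    Prop :=
  exists2 A : 'Hom(V, W), A \in intertwiners H rho tau & bijective A.

Definition occurs_in (C : numClosedFieldType) (gT : finGroupType)
    (H : {set gT}) (V W : vectType C) (rho : gT -> 'End(V)) (tau : gT -> 'End(W)) :
    Prop :=
  exists2 A : 'Hom(V, W), A \in intertwiners H rho tau & injective A.

Definition orthonormal_basis (C : numClosedFieldType) (V : vectType C)
    (dotV : V -> V -> C) (U : {vspace V}) (e : seq V) : Prop :=
  basis_of U e /\
  forall k l : 'I_(size e), dotV e`_k e`_l = (k == l)%:R.

(* The Hilbert-Schmidt inner product of Hom(V, W), computed in a basis e of V;
   it does not depend on e as long as e is orthonormal. *)
Definition hs_dot (C : numClosedFieldType) (V W : vectType C)
    (dotW : W -> W -> C) (e : seq V) (S T : 'Hom(V, W)) : C :=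
  \sum_(v <- e) dotW (S v) (T v).

Definition fun_dot (C : numClosedFieldType) (W : finType)
    (f1 f2 : {ffun W -> C^o}) : C :=
  \sum_w f1 w * (f2 w)^*.

Definition perm_rep (C : numClosedFieldType) (gT : finGroupType) (W : finType)
    (a : gT -> W -> W) (g : gT) : 'End({ffun W -> C^o}) :=
  linfun (fun f : {ffun W -> C^o} => [ffun w => f (a (g^-1)%g w)] : {ffun W -> C^o}).
Arguments perm_rep C {gT W} a g.

(* The tensor product of the spaces E x, x : X, is realized by coordinates in
   the basis of tensors of vectors of the library bases vbasis {:E x}; these
   bases are not assumed to be orthonormal, hence the Gram coefficients in
   tensor_dot. *)
Definition tensor_index (C : numClosedFieldType) (X : finType)
    (E : X -> vectType C) : finType :=
  {dffun forall x : X, 'I_(\dim {:E x})}.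

Definition pure_tensor (C : numClosedFieldType) (X : finType)
    (E : X -> vectType C) (v : forall x, E x) : {ffun tensor_index E -> C^o} :=
  [ffun b : tensor_index E => \prod_x coord (vbasis {:E x}) (b x) (v x)].

Definition tensor_vbasis (C : numClosedFieldType) (X : finType)
    (E : X -> vectType C) (b : tensor_index E) (x : X) : E x :=
  (vbasis {:E x})`_(b x).

(* The linear map sending pure_tensor v to Phi v, for Phi multilinear. *)
Definition tensor_lift (C : numClosedFieldType) (X : finType)
    (E : X -> vectType C) (W : vectType C) (Phi : (forall x, E x) -> W) :
    'Hom({ffun tensor_index E -> C^o}, W) :=
  linfun (fun t : {ffun tensor_index E -> C^o} =>
    \sum_b t b *: Phi (tensor_vbasis b)).

Definition tensor_dot (C : numClosedFieldType) (X : finType)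
    (E : X -> vectType C) (dotE : forall x, E x -> E x -> C)
    (t t' : {ffun tensor_index E -> C^o}) : C :=
  \sum_b \sum_b' t b * (t' b')^* *
    \prod_x dotE x (tensor_vbasis b x) (tensor_vbasis b' x).

Definition tens2_index (C : numClosedFieldType) (A B : vectType C) : finType :=
  ('I_(\dim {:A}) * 'I_(\dim {:B}))%type.

Definition pure2 (C : numClosedFieldType) (A B : vectType C) (a : A) (b : B) :
    {ffun tens2_index A B -> C^o} :=
  [ffun k : tens2_index A B =>
     coord (vbasis {:A}) k.1 a * coord (vbasis {:B}) k.2 b].

Definition lift2 (C : numClosedFieldType) (A B W : vectType C) (Phi : A -> B -> W) :
    'Hom({ffun tens2_index A B -> C^o}, W) :=
  linfun (fun t : {ffun tens2_index A B -> C^o} =>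
    \sum_k t k *: Phi (vbasis {:A})`_k.1 (vbasis {:B})`_k.2).

Definition dot2 (C : numClosedFieldType) (A B : vectType C)
    (dotA : A -> A -> C) (dotB : B -> B -> C)
    (t t' : {ffun tens2_index A B -> C^o}) : C :=
  \sum_k \sum_l t k * (t' l)^* *
    (dotA (vbasis {:A})`_k.1 (vbasis {:A})`_l.1 *
     dotB (vbasis {:B})`_k.2 (vbasis {:B})`_l.2).

Definition left_transversal (gT : finGroupType) (H S : {set gT}) : Prop :=
  forall g : gT, exists! s : gT, s \in S /\ (s^-1 * g)%g \in H.

(* The space of Ind_H^G W: the function w stands for \sum_(s in S) tau(s) w_s. *)
Definition ind_space (C : numClosedFieldType) (gT : finGroupType) (S : {set gT})
    (W : vectType C) : vectType C :=
  {ffun {s : gT | s \in S} -> W}.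

(* tau(g) tau(s) w = tau(t) rho(t^-1 g s) w, where t is the unique element of S
   with t^-1 g s \in H. *)
Definition ind_rep (C : numClosedFieldType) (gT : finGroupType) (H S : {set gT})
    (W : vectType C) (rho : gT -> 'End(W)) (g : gT) : 'End(ind_space S W) :=
  linfun (fun w : {ffun {s : gT | s \in S} -> W} =>
    [ffun t : {s : gT | s \in S} =>
       \sum_(s : {s : gT | s \in S} | ((val t)^-1 * g * val s)%g \in H)
         rho ((val t)^-1 * g * val s)%g (w s)] : {ffun {s : gT | s \in S} -> W}).

Definition ind_dot (C : numClosedFieldType) (gT : finGroupType) (S : {set gT})
    (W : vectType C) (dotW : W -> W -> C) (w w' : {ffun {s : gT | s \in S} -> W}) : C :=
  \sum_s dotW (w s) (w' s).

Definition diamond (C : numClosedFieldType) (gT : finGroupType) (S : {set gT})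
    (W : vectType C) (X : finType) (a : gT -> X -> X)
    (L : 'Hom(W, {ffun X -> C^o})) : 'Hom(ind_space S W, {ffun X -> C^o}) :=
  linfun (fun w : {ffun {s : gT | s \in S} -> W} =>
    [ffun x => (sqrtC #|S|%:R)^-1 *
               \sum_(s : {s : gT | s \in S}) L (w s) (a ((val s)^-1)%g x)]
      : {ffun X -> C^o}).

Definition inertia (C : numClosedFieldType) (fT gT : finGroupType) (X : finType)
    (aX : laction gT X) (n : nat) (cls : X -> 'I_n) (V : 'I_n -> vectType C)
    (sigma : forall i, fT -> 'End(V i)) : {set gT} :=
  [set g : gT | `[< forall x,
     equivalent_rep [set: fT] (sigma (cls (aX g x))) (sigma (cls x)) >]].

(* Transport of v : P i along i = j; the value d is used only when i != j. *)
Definition transport (n : nat) (P : 'I_n -> Type) (i j : 'I_n) (d : P j) (v : P i) :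
    P j :=
  if i =P j is ReflectT e then ecast k (P k) e v else d.

Definition sigma_tilde (C : numClosedFieldType) (fT gT : finGroupType)
    (X : finType) (aX : laction gT X) (n : nat) (cls : X -> 'I_n)
    (V : 'I_n -> vectType C) (sigma : forall i, fT -> 'End(V i))
    (p : wreath fT aX) : 'End({ffun tensor_index (fun x => V (cls x)) -> C^o}) :=
  tensor_lift (fun v : forall x, V (cls x) =>
    pure_tensor (fun x =>
      sigma (cls x) (p.1 x) (transport (P := V) 0 (v (aX (p.2^-1)%g x))))).

Definition wr_rep (C : numClosedFieldType) (fT gT : finGroupType)
    (X : finType) (aX : laction gT X) (n : nat) (cls : X -> 'I_n)
    (V : 'I_n -> vectType C) (sigma : forall i, fT -> 'End(V i))
    (U : vectType C) (eta : gT -> 'End(U)) (p : wreath fT aX) :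
    'End({ffun tens2_index {ffun tensor_index (fun x => V (cls x)) -> C^o} U -> C^o}) :=
  lift2 (fun t u => pure2 (sigma_tilde cls sigma p t) (eta p.2 u)).

(* The set J, with {0, .., m_i - 1} in place of {1, .., m_i}. *)
Definition mult_index (X : finType) (n : nat) (cls : X -> 'I_n) (m : 'I_n -> nat) :
    finType :=
  {dffun forall x : X, 'I_(m (cls x))}.

Definition mult_act (gT : finGroupType) (X Z : finType) (aX : laction gT X)
    (aZ : laction gT Z) (n : nat) (cls : X -> 'I_n) (m : 'I_n -> nat)
    (g : gT) (w : Z * mult_index cls m) : Z * mult_index cls m :=
  (aZ g w.1,
   [ffun x => transport (P := fun i => 'I_(m i)) (w.2 x) (w.2 (aX (g^-1)%g x))]).

Definition tensor_T (C : numClosedFieldType) (X Y : finType) (n : nat)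
    (cls : X -> 'I_n) (V : 'I_n -> vectType C) (m : 'I_n -> nat)
    (T : forall i, (m i).-tuple 'Hom(V i, {ffun Y -> C^o}))
    (j : mult_index cls m) :
    'Hom({ffun tensor_index (fun x => V (cls x)) -> C^o},
         {ffun {ffun X -> Y} -> C^o}) :=
  tensor_lift (fun v : forall x, V (cls x) =>
    [ffun phi : {ffun X -> Y} => \prod_x tnth (T (cls x)) (j x) (v x) (phi x)]
      : {ffun {ffun X -> Y} -> C^o}).

Definition hat_map (C : numClosedFieldType) (X Y Z : finType) (n : nat)
    (cls : X -> 'I_n) (V : 'I_n -> vectType C) (m : 'I_n -> nat)
    (T : forall i, (m i).-tuple 'Hom(V i, {ffun Y -> C^o}))
    (U : vectType C) (A : 'Hom(U, {ffun Z * mult_index cls m -> C^o})) :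
    'Hom({ffun tens2_index {ffun tensor_index (fun x => V (cls x)) -> C^o} U -> C^o},
         {ffun {ffun X -> Y} * Z -> C^o}) :=
  lift2 (fun t u =>
    [ffun w : {ffun X -> Y} * Z => \sum_j A u (w.2, j) * tensor_T T j t w.1]
      : {ffun {ffun X -> Y} * Z -> C^o}).

(* Main.v *)
Require Import Defs.
From HB Require Import structures.
From mathcomp Require Import all_boot all_order all_fingroup all_algebra.
From mathcomp Require Import boolp classical_sets functions.

(** The map is the composite of two maps, and each of them is an explicit
bijection that preserves Hilbert-Schmidt inner products.

Diamond is Frobenius reciprocity. An intertwiner P out of the induced space
commutes with every transversal element s, so its values on the block of s are
translates of its values on the block of 1; hence P is the diamond of its
restriction to that block, scaled by the square root of |S|. The |S| blocks
contribute equally to the inner product, and the scalar 1 / sqrt |S| in the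
definition compensates for this.

Hat is an expansion in a basis. For fixed u and z, an intertwiner L of F wr I
gives the slice v |-> L(v (x) u)(., z), which intertwines the actions of F^X
on the tensor product of the V_x and on L(Y^X). The maps T_j span the space of
such slices (tensor_T_span): a linear map between the two tensor products is a
sum of product maps; averaging over F^X leaves the slice fixed and averages a
product map factor by factor; and each averaged factor is an F-intertwiner, so
a combination of the given T_(x,h). The T_j are orthonormal
(tensor_T_orthonormal), because the Hilbert-Schmidt product of product maps is
the product of those of the factors. So a slice has unique coordinates, and
they depend linearly on u: these are the values of the wanted map from U to
L(Z x J). Equivariance under I passes between both sides because
composing T_j with the action of (f, g) in F wr I gives the translate of
T_(g^-1 j) by (f, g) (tensor_T_sigma_tilde), and coordinates are unique.

For the inner products, sum_k <S b_k, T b_k> takes the same value for all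
families (b_k) with v = sum_k <v, b_k> b_k (frame_sum_dot). Such families are
compatible with tensor products and induction, so the inner product on the
induced space can be computed in blocks of pure tensors of basis vectors. *)

Set Implicit Arguments.
Unset Strict Implicit.
Unset Printing Implicit Defensive.

Import GRing.Theory Num.Theory.

Local Open Scope group_scope.
Local Open Scope ring_scope.

(** * Finite sums *)

Lemma prod_sum_dffun (R : comNzRingType) (X : finType) (K : X -> finType)
    (F : forall x, K x -> R) :
  \prod_x \sum_(k : K x) F x k
  = \sum_(g : {dffun forall x, K x}) \prod_x F x (g x).
Proof.
rewrite (reindex (@dffun_of_fprod X K)); last exact/onW_bij/dffun_of_fprod_bij.
transitivity (\sum_(t : fprod K) \prod_(x in X) [ffun k => F x k] (t x)).
  rewrite big_fprod; transitivity
    (\prod_x \sum_(u in tagged_with K x) untag 0 [ffun k => F x k] u).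
    apply: eq_bigr => x _.
    rewrite -(big_tag (fun x => [ffun k => F x k] : K x -> R)).
    by apply: eq_bigr => k _; rewrite ffunE.
  exact: bigA_distr_big_dep.
by apply: eq_bigr => t _; apply: eq_bigr => x _; rewrite !ffunE.
Qed.

Lemma sum_pair (V : nmodType) (K L : finType) (F : K * L -> V) :
  \sum_k F k = \sum_i \sum_j F (i, j).
Proof. by rewrite pair_bigA; apply: eq_bigr => -[]. Qed.

Lemma ffun_natr_eq (R : comNzRingType) (X : finType) (K : X -> finType)
    (f g : {dffun forall x, K x}) :
  \prod_x ((f x == g x)%:R : R) = (f == g)%:R.
Proof.
have [->|/eqP neq] := eqVneq f g; first by rewrite big1 // => x _; rewrite eqxx.
have [x fgx] : exists x, f x != g x.
  apply/existsP; apply: contra_notT neq; rewrite negb_exists => /forallP eqfg.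
  by apply/ffunP => x; apply/eqP; rewrite -[_ == _]negbK eqfg.
by rewrite (bigD1 x) //= (negbTE fgx) mul0r.
Qed.

(** * Hermitian products and Parseval frames *)

Section Frames.
Variable C : numClosedFieldType.

Lemma conjM (a b : C) : (a * b)^* = a^* * b^*. Proof. exact: rmorphM. Qed.

Lemma conj_sum (K : Type) (r : seq K) (P : pred K) (F : K -> C) :
  (\sum_(k <- r | P k) F k)^* = \sum_(k <- r | P k) (F k)^*.
Proof. exact: rmorph_sum. Qed.

Lemma conj_prod (K : Type) (r : seq K) (P : pred K) (F : K -> C) :
  (\prod_(k <- r | P k) F k)^* = \prod_(k <- r | P k) (F k)^*.
Proof. exact: rmorph_prod. Qed.

(** The algebraic part of an inner product: linearity on the left and Hermitian
symmetry, from which conjugate linearity on the right follows. *)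
Definition hermitian_dot (V : vectType C) (dot : V -> V -> C) : Prop :=
  (forall a u v w, dot (a *: u + v) w = a * dot u w + dot v w) /\
  (forall u v, dot u v = (dot v u)^*).

Section HermitianDot.
Variables (V : vectType C) (dot : V -> V -> C) (dotP : hermitian_dot dot).

Lemma hdotC u v : dot u v = (dot v u)^*. Proof. by case: dotP. Qed.

Lemma hdotl0 w : dot 0 w = 0.
Proof. by have := dotP.1 (-1) 0 0 w; rewrite scaler0 add0r mulN1r addNr. Qed.

Lemma hdotDl u v w : dot (u + v) w = dot u w + dot v w.
Proof. by have := dotP.1 1 u v w; rewrite scale1r mul1r. Qed.

Lemma hdotZl a u w : dot (a *: u) w = a * dot u w.
Proof. by have := dotP.1 a u 0 w; rewrite hdotl0 !addr0. Qed.

Lemma hdot_suml (K : Type) (r : seq K) (P : pred K) (F : K -> V) w :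
  dot (\sum_(k <- r | P k) F k) w = \sum_(k <- r | P k) dot (F k) w.
Proof.
apply: (big_morph (dot^~ w)); [by move=> u v; exact: hdotDl | exact: hdotl0].
Qed.

Lemma hdotr0 w : dot w 0 = 0. Proof. by rewrite hdotC hdotl0 rmorph0. Qed.

Lemma hdotZr a u w : dot w (a *: u) = a^* * dot w u.
Proof. by rewrite [LHS]hdotC hdotZl conjM [dot w u]hdotC. Qed.

Lemma hdot_sumr (K : Type) (r : seq K) (P : pred K) (F : K -> V) w :
  dot w (\sum_(k <- r | P k) F k) = \sum_(k <- r | P k) dot w (F k).
Proof.
by rewrite hdotC hdot_suml conj_sum; apply: eq_bigr => k _; rewrite [RHS]hdotC.
Qed.

End HermitianDot.

Lemma dot_hermitian (V : vectType C) (dot : {dot V for Num.conj}) :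
  hermitian_dot dot.
Proof.
split=> [a u v w | u v]; first exact: linearPl.
by rewrite hermC expr0 mul1r.
Qed.

Lemma fun_dot_hermitian (W : finType) : hermitian_dot (@fun_dot C W).
Proof.
split=> [a u v w | u v]; rewrite /fun_dot.
  rewrite mulr_sumr -big_split; apply: eq_bigr => i _.
  by rewrite !ffunE mulrDl -mulrA.
by rewrite conj_sum; apply: eq_bigr => i _; rewrite conjM conjCK mulrC.
Qed.

(** This reproducing formula, rather than orthonormality, is what the
Hilbert-Schmidt product depends on; it is inherited by tensor products and
induced spaces without counting dimensions. *)
Definition parseval_frame (V : vectType C) (dot : V -> V -> C) (K : finType)
    (b : K -> V) : Prop :=
  forall v, \sum_k dot v (b k) *: b k = v.

Lemma orthonormal_basis_frame (V : vectType C) (dot : V -> V -> C) (e : seq V) :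
  hermitian_dot dot -> orthonormal_basis dot fullv e ->
  parseval_frame dot (fun k : 'I_(size e) => e`_k).
Proof.
move=> dotP [be oe] v.
rewrite [RHS](coord_basis (X := in_tuple e) be (memvf v)).
apply: eq_bigr => k _; congr (_ *: _).
rewrite {1}(coord_basis (X := in_tuple e) be (memvf v)) (hdot_suml dotP).
rewrite (bigD1 k) //=.
rewrite (hdotZl dotP) oe eqxx mulr1 big1 ?addr0 // => l lk.
by rewrite (hdotZl dotP) oe (negbTE lk) mulr0.
Qed.

(** Expanding [b k] in the frame [c] on one side, and [c l] in the frame [b] on
the other, gives the same double sum with coefficients <b_k, c_l>. *)
Lemma frame_sum_dot (V W : vectType C) (dotV : V -> V -> C) (dotW : W -> W -> C)
    (K L : finType) (b : K -> V) (c : L -> V) (S T : 'Hom(V, W)) :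
  hermitian_dot dotV -> hermitian_dot dotW ->
  parseval_frame dotV b -> parseval_frame dotV c ->
  \sum_k dotW (S (b k)) (T (b k)) = \sum_l dotW (S (c l)) (T (c l)).
Proof.
move=> hV hW bP cP.
transitivity (\sum_k \sum_l dotV (b k) (c l) * dotW (S (c l)) (T (b k))).
  apply: eq_bigr => k _; rewrite -{1}(cP (b k)) linear_sum (hdot_suml hW).
  by apply: eq_bigr => l _; rewrite linearZ (hdotZl hW).
rewrite exchange_big; apply: eq_bigr => l _.
rewrite -[in T (c l)](bP (c l)) linear_sum (hdot_sumr hW).
by apply: eq_bigr => k _; rewrite linearZ (hdotZr hW) -(hdotC hV).
Qed.

Lemma hs_dot_frame (V W : vectType C) (dotV : V -> V -> C) (dotW : W -> W -> C)
    (e : seq V) (K : finType) (b : K -> V) (S T : 'Hom(V, W)) :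
  hermitian_dot dotV -> hermitian_dot dotW ->
  orthonormal_basis dotV fullv e -> parseval_frame dotV b ->
  hs_dot dotW e S T = \sum_k dotW (S (b k)) (T (b k)).
Proof.
move=> hV hW eP bP; rewrite /hs_dot (big_nth 0) big_mkord.
exact: (frame_sum_dot _ _ hV hW (orthonormal_basis_frame hV eP) bP).
Qed.

End Frames.

(** * Tensor products in coordinates *)

Section Tensors.
Variable C : numClosedFieldType.

Lemma scale_regE (a : C) (b : C^o) : a *: b = a * b. Proof. by []. Qed.

Lemma ffun_linear (W : vectType C) (K : finType) (F : K -> W) :
  linear (fun t : {ffun K -> C^o} => \sum_k t k *: F k).
Proof.
move=> a t t'; rewrite scaler_sumr -big_split /=; apply: eq_bigr => k _.
by rewrite !ffunE scalerDl -scalerA.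
Qed.

Lemma coord_vbasisK (A : vectType C) (v : A) :
  \sum_i coord (vbasis {:A}) i v *: (vbasis {:A})`_i = v.
Proof. by rewrite -(coord_vbasis (memvf v)). Qed.

Lemma coord_vbasisE (A : vectType C) (i j : 'I_(\dim {:A})) :
  coord (vbasis {:A}) i (vbasis {:A})`_j = (i == j)%:R.
Proof. by rewrite coord_free ?(basis_free (vbasisP _)) // eq_sym. Qed.

Lemma ffun_delta_sum (K : finType) (t : {ffun K -> C^o}) :
  t = \sum_k t k *: ([ffun k' => (k' == k)%:R] : {ffun K -> C^o}).
Proof.
apply/ffunP => k; rewrite sum_ffunE (bigD1 k) //= !ffunE eqxx scale_regE mulr1.
rewrite big1 ?addr0 // => l lk.
by rewrite !ffunE eq_sym (negbTE lk) scale_regE mulr0.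
Qed.

Section TensorProduct.
Variables (X : finType) (E : X -> vectType C).

Lemma pure_tensor_basis (b : tensor_index E) :
  pure_tensor (tensor_vbasis b) = [ffun b' => (b' == b)%:R].
Proof.
apply/ffunP => b'; rewrite !ffunE -ffun_natr_eq.
by apply: eq_bigr => x _; rewrite coord_vbasisE.
Qed.

Lemma tensor_pure_sum (t : {ffun tensor_index E -> C^o}) :
  t = \sum_b t b *: pure_tensor (tensor_vbasis b).
Proof.
rewrite [LHS]ffun_delta_sum; apply: eq_bigr => b _.
by rewrite pure_tensor_basis.
Qed.

(** A product of linear functionals of the factors is the typical multilinear
form; it is recovered from its values on basis tensors by distributivity. *)
Lemma multilinear_tensor (l : forall x, E x -> C) (v : forall x, E x) :
  (forall x, scalar (l x)) ->
  \sum_(b : tensor_index E)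
     pure_tensor v b * \prod_x l x (tensor_vbasis b x)
  = \prod_x l x (v x).
Proof.
move=> linl.
transitivity (\prod_x \sum_i
    coord (vbasis {:E x}) i (v x) * l x (vbasis {:E x})`_i).
  rewrite prod_sum_dffun; apply: eq_bigr => b _.
  by rewrite ffunE -big_split.
apply: eq_bigr => x _.
pose lx : {scalar E x} :=
  HB.pack (l x) (GRing.isLinear.Build _ _ _ _ (l x) (linl x)).
rewrite -[in RHS](coord_vbasisK (v x)) -[l x]/(lx : _ -> _) linear_sum.
by apply: eq_bigr => i _; rewrite linearZ_LR.
Qed.

Lemma tensor_liftE (W : vectType C) (Phi : (forall x, E x) -> W) t :
  tensor_lift Phi t = \sum_b t b *: Phi (tensor_vbasis b).
Proof. by rewrite /tensor_lift linfunE //; exact: ffun_linear. Qed.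

(** The universal property of the tensor product. Multilinearity of [Phi] is
given by writing its coordinates as products of linear functionals, the form
in which it occurs below; this avoids updating one entry of a dependent
family. *)
Lemma tensor_lift_pure (K : finType) (l : K -> forall x, E x -> C)
    (Phi : (forall x, E x) -> {ffun K -> C^o}) (v : forall x, E x) :
  (forall k x, scalar (l k x)) ->
  (forall w k, Phi w k = \prod_x l k x (w x)) ->
  tensor_lift Phi (pure_tensor v) = Phi v.
Proof.
move=> linl PhiE; rewrite tensor_liftE; apply/ffunP => k.
rewrite sum_ffunE PhiE -multilinear_tensor //.
by apply: eq_bigr => b _; rewrite !ffunE PhiE.
Qed.

Lemma tensor_hom_eq (W : vectType C)
    (f g : 'Hom({ffun tensor_index E -> C^o}, W)) :
  (forall v, f (pure_tensor v) = g (pure_tensor v)) -> f = g.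
Proof.
move=> fg; apply/lfunP => t; rewrite (tensor_pure_sum t) !linear_sum.
by apply: eq_bigr => b _; rewrite !linearZ /= fg.
Qed.

Section Dot.
Variable dotE : forall x, E x -> E x -> C.
Hypothesis dotP : forall x, hermitian_dot (@dotE x).

Lemma tensor_dot_hermitian : hermitian_dot (tensor_dot dotE).
Proof.
split=> [a u v w | u v]; rewrite /tensor_dot.
  rewrite mulr_sumr -big_split; apply: eq_bigr => b _.
  rewrite mulr_sumr -big_split; apply: eq_bigr => b' _.
  by rewrite !ffunE !mulrDl !mulrA.
rewrite exchange_big conj_sum; apply: eq_bigr => b _.
rewrite conj_sum; apply: eq_bigr => b' _.
rewrite !conjM conjCK conj_prod [u _ * _]mulrC; congr (_ * _).
by apply: eq_bigr => x _; rewrite -(hdotC (dotP x)).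
Qed.

Lemma tensor_dot_pure (v w : forall x, E x) :
  tensor_dot dotE (pure_tensor v) (pure_tensor w) = \prod_x dotE (v x) (w x).
Proof.
rewrite /tensor_dot.
transitivity (\sum_b pure_tensor v b *
    \prod_x dotE (tensor_vbasis b x) (w x)).
  apply: eq_bigr => b _.
  have -> : \prod_x dotE (tensor_vbasis b x) (w x) =
      (\sum_b' pure_tensor w b' *
        \prod_x dotE (tensor_vbasis b' x) (tensor_vbasis b x))^*.
    rewrite (multilinear_tensor (l := fun x u => dotE u (tensor_vbasis b x))).
      by rewrite conj_prod; apply: eq_bigr => x _; rewrite -(hdotC (dotP x)).
    by move=> x a u u'; rewrite (dotP x).1.
  rewrite conj_sum mulr_sumr; apply: eq_bigr => b' _.
  rewrite conjM conj_prod mulrA; congr (_ * _).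
  by apply: eq_bigr => x _; rewrite -(hdotC (dotP x)).
apply: (multilinear_tensor (l := fun x u => dotE u (w x))).
by move=> x a u u'; rewrite (dotP x).1.
Qed.

(** Both sides are linear in the tensor; on a pure tensor the reproducing
formula is the product of those of the factors. *)
Lemma tensor_frame (K : X -> finType) (b : forall x, K x -> E x) :
  (forall x, parseval_frame (@dotE x) (b x)) ->
  parseval_frame (tensor_dot dotE)
    (fun k : {dffun forall x, K x} => pure_tensor (fun x => b x (k x))).
Proof.
move=> bP t; pose f u := \sum_(k : {dffun forall x, K x})
  tensor_dot dotE u (pure_tensor (fun x => b x (k x)))
    *: pure_tensor (fun x => b x (k x)).
have linf : linear f.
  move=> a u v; rewrite /f scaler_sumr -big_split; apply: eq_bigr => k _.
  by rewrite tensor_dot_hermitian.1 scalerDl scalerA.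
rewrite -[LHS]/(f t) -(linfunE linf).
suff -> : linfun f = \1%VF by rewrite id_lfunE.
apply: tensor_hom_eq => v; rewrite (linfunE linf) id_lfunE /f.
apply/ffunP => c; rewrite sum_ffunE !ffunE.
transitivity (\prod_x \sum_k
    dotE (v x) (b x k) * coord (vbasis {:E x}) (c x) (b x k)).
  rewrite prod_sum_dffun; apply: eq_bigr => k _.
  by rewrite !ffunE tensor_dot_pure scale_regE -big_split.
apply: eq_bigr => x _; rewrite -[in RHS](bP x (v x)) linear_sum /=.
by apply: eq_bigr => k _; rewrite linearZ.
Qed.

End Dot.
End TensorProduct.

Section TwoFactors.
Variables (A B : vectType C).

Lemma lift2E (W : vectType C) (Phi : A -> B -> W) t :
  lift2 Phi t = \sum_k t k *: Phi (vbasis {:A})`_k.1 (vbasis {:B})`_k.2.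
Proof.
rewrite /lift2 linfunE //.
exact: (ffun_linear (fun k : tens2_index A B =>
  Phi (vbasis {:A})`_k.1 (vbasis {:B})`_k.2)).
Qed.

Lemma lift2_pure (W : vectType C) (Phi : A -> B -> W) a b :
  (forall b, linear (Phi^~ b)) -> (forall a, linear (Phi a)) ->
  lift2 Phi (pure2 a b) = Phi a b.
Proof.
move=> linl linr; rewrite lift2E.
rewrite -(linfunE (linl b)) -[in RHS](coord_vbasisK a) linear_sum.
rewrite sum_pair /=.
apply: eq_bigr => i _; rewrite linearZ /= (linfunE (linl b)).
rewrite -(linfunE (linr _)) -[in RHS](coord_vbasisK b) linear_sum scaler_sumr.
by apply: eq_bigr => j _; rewrite linearZ /= ffunE scalerA (linfunE (linr _)).
Qed.

Lemma pure2_basis (k : tens2_index A B) :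
  pure2 (vbasis {:A})`_k.1 (vbasis {:B})`_k.2 = [ffun k' => (k' == k)%:R].
Proof.
case: k => i j; apply/ffunP => -[i' j']; rewrite !ffunE /= !coord_vbasisE.
by rewrite -natrM mulnb xpair_eqE.
Qed.

Lemma tensor2_hom_eq (W : vectType C)
    (f g : 'Hom({ffun tens2_index A B -> C^o}, W)) :
  (forall a b, f (pure2 a b) = g (pure2 a b)) -> f = g.
Proof.
move=> fg; apply/lfunP => t; rewrite (ffun_delta_sum t) !linear_sum.
by apply: eq_bigr => k _; rewrite !linearZ /= -pure2_basis fg.
Qed.

Lemma pure2_linearl b : linear ((@pure2 C A B)^~ b).
Proof.
by move=> c u v; apply/ffunP => k; rewrite !ffunE linearP /= mulrDl -mulrA.
Qed.

Lemma pure2_linearr a : linear (@pure2 C A B a).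
Proof.
move=> c u v; apply/ffunP => k; rewrite !ffunE linearP /= mulrDr.
by rewrite !scale_regE mulrCA.
Qed.

Variables (dotA : A -> A -> C) (dotB : B -> B -> C).
Hypotheses (dotAP : hermitian_dot dotA) (dotBP : hermitian_dot dotB).

Lemma dot2_hermitian : hermitian_dot (dot2 dotA dotB).
Proof.
split=> [a u v w | u v]; rewrite /dot2.
  rewrite mulr_sumr -big_split; apply: eq_bigr => b _.
  rewrite mulr_sumr -big_split; apply: eq_bigr => b' _.
  by rewrite !ffunE !mulrDl !mulrA.
rewrite exchange_big conj_sum; apply: eq_bigr => b _.
rewrite conj_sum; apply: eq_bigr => b' _.
by rewrite !conjM conjCK -(hdotC dotAP) -(hdotC dotBP) [u _ * _]mulrC.
Qed.

Lemma dot2_pure a b a' b' :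
  dot2 dotA dotB (pure2 a b) (pure2 a' b') = dotA a a' * dotB b b'.
Proof.
have dotE (D : vectType C) (dot : D -> D -> C) (dotP : hermitian_dot dot) u v :
    dot u v = \sum_i \sum_j coord (vbasis {:D}) i u *
      (coord (vbasis {:D}) j v)^* * dot (vbasis {:D})`_i (vbasis {:D})`_j.
  rewrite -{1}(coord_vbasisK u) (hdot_suml dotP); apply: eq_bigr => i _.
  rewrite -{1}(coord_vbasisK v) (hdot_sumr dotP); apply: eq_bigr => j _.
  by rewrite (hdotZl dotP) (hdotZr dotP) mulrA.
rewrite (dotE _ _ dotAP a) (dotE _ _ dotBP b) /dot2 big_distrlr sum_pair /=.
apply: eq_bigr => i _; apply: eq_bigr => j _; rewrite big_distrlr sum_pair /=.
apply: eq_bigr => i' _; apply: eq_bigr => j' _.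
rewrite !ffunE /= conjM.
by rewrite [RHS]mulrACA; congr (_ * _); rewrite mulrACA.
Qed.

Lemma frame2 (K L : finType) (b : K -> A) (c : L -> B) :
  parseval_frame dotA b -> parseval_frame dotB c ->
  parseval_frame (dot2 dotA dotB) (fun k : K * L => pure2 (b k.1) (c k.2)).
Proof.
move=> bP cP t; pose f u := \sum_(k : K * L)
  dot2 dotA dotB u (pure2 (b k.1) (c k.2)) *: pure2 (b k.1) (c k.2).
have linf : linear f.
  move=> a u v; rewrite /f scaler_sumr -big_split; apply: eq_bigr => k _.
  by rewrite dot2_hermitian.1 scalerDl scalerA.
rewrite -[LHS]/(f t) -(linfunE linf).
suff -> : linfun f = \1%VF by rewrite id_lfunE.
apply: tensor2_hom_eq => u v; rewrite (linfunE linf) id_lfunE /f.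
rewrite -[RHS](linfunE (pure2_linearl v)) -[in RHS](bP u) linear_sum.
rewrite sum_pair /=.
apply: eq_bigr => k _; rewrite linearZ /= (linfunE (pure2_linearl v)).
have -> : pure2 (b k) v = \sum_l dotB v (c l) *: pure2 (b k) (c l).
  rewrite -[LHS](linfunE (pure2_linearr _)) -[in LHS](cP v) linear_sum.
  by apply: eq_bigr => l _; rewrite linearZ /= (linfunE (pure2_linearr _)).
by rewrite scaler_sumr; apply: eq_bigr => l _; rewrite dot2_pure scalerA.
Qed.

End TwoFactors.
End Tensors.

(** * Induction and Frobenius reciprocity *)

Section PermutationRep.
Variables (C : numClosedFieldType) (gT : finGroupType) (X : finType).

Lemma perm_repE (a : gT -> X -> X) g f x :
  perm_rep C a g f x = f (a (g^-1)%g x).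
Proof.
rewrite /perm_rep linfunE ?ffunE // => c u v.
by apply/ffunP => y; rewrite !ffunE.
Qed.

Lemma fun_dot_comp (u v : {ffun X -> C^o}) (p : X -> X) :
  bijective p -> \sum_x u (p x) * (v (p x))^* = fun_dot u v.
Proof. by move=> bp; rewrite /fun_dot [RHS](reindex p) //; apply: onW_bij. Qed.

End PermutationRep.

Section Induction.
Variables (C : numClosedFieldType) (gT : finGroupType) (H S : {set gT}).
Hypotheses (H1 : 1%g \in H) (S1 : 1%g \in S) (ST : left_transversal H S).
Variables (W : vectType C) (rho : gT -> 'End(W)).
Hypothesis rho1 : forall w, rho 1%g w = w.
Variables (X : finType) (a : gT -> X -> X).
Hypotheses (a1 : forall x, a 1%g x = x).
Hypotheses (aM : forall g h x, a (g * h)%g x = a g (a h x)).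

Local Notation SS := {s : gT | s \in S}.

Definition ind_vec (s : SS) (w : W) : ind_space S W :=
  [ffun t => if t == s then w else 0].

Lemma ind_vec_linear s : linear (ind_vec s).
Proof.
move=> c u v; apply/ffunP => t; rewrite !ffunE.
by case: (t == s); rewrite ?scaler0 ?addr0.
Qed.

Lemma ind_vec_sum (w : ind_space S W) : w = \sum_s ind_vec s (w s).
Proof.
apply/ffunP => t; rewrite sum_ffunE (bigD1 t) //= ffunE eqxx big1 ?addr0 //.
by move=> s st; rewrite ffunE eq_sym (negbTE st).
Qed.

Lemma ind_hom_eq (V : vectType C) (P Q : 'Hom(ind_space S W, V)) :
  (forall s w, P (ind_vec s w) = Q (ind_vec s w)) -> P = Q.
Proof.
move=> PQ; apply/lfunP => w; rewrite (ind_vec_sum w) !linear_sum.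
by apply: eq_bigr => s _; exact: PQ.
Qed.

Lemma transversal_uniq (g : gT) (s t : SS) :
  ((val s)^-1 * g)%g \in H -> ((val t)^-1 * g)%g \in H -> t = s.
Proof.
move=> sH tH; have [r [_ runiq]] := ST g.
apply: val_inj.
by rewrite -(runiq _ (conj (valP s) sH)) (runiq _ (conj (valP t) tH)).
Qed.

Lemma transversal_ex (g : gT) : exists s : SS, ((val s)^-1 * g)%g \in H.
Proof. by have [r [[rS rH] _]] := ST g; exists (exist _ r rS). Qed.

Lemma ind_repE g w t : ind_rep H S rho g w t =
  \sum_(s : SS | ((val t)^-1 * g * val s)%g \in H)
    rho ((val t)^-1 * g * val s)%g (w s).
Proof.
rewrite /ind_rep linfunE ?ffunE // => c u v; apply/ffunP => r.
rewrite !ffunE scaler_sumr -big_split; apply: eq_bigr => s _.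
by rewrite !ffunE linearP.
Qed.

Let one : SS := exist _ 1%g S1.

(** Used in two cases: for [g] in [H], where the block of 1 turns out to be a
copy of [W] as an [H]-representation, and for [g = s], where [s] carries the
block of 1 identically onto the block of [s]. *)
Lemma ind_rep_base g (s : SS) w : ((val s)^-1 * g)%g \in H ->
  ind_rep H S rho g (ind_vec one w) = ind_vec s (rho ((val s)^-1 * g)%g w).
Proof.
move=> sH; apply/ffunP => t; rewrite ind_repE ffunE.
under eq_bigr => r _ do rewrite ffunE.
case: eqP => [-> | ts].
  rewrite (bigD1 one) /= ?mulg1 // eqxx big1 ?addr0 // => r /andP[_ /negbTE ->].
  by rewrite linear0.
rewrite big1 // => r; case: eqP => [-> /= | _ _]; last by rewrite linear0.
by rewrite mulg1 => tH; case: ts; exact: transversal_uniq sH tH.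
Qed.

Local Notation lambda := (perm_rep C a).

Lemma diamondE (L : 'Hom(W, _)) (w : ind_space S W) x : diamond S a L w x =
  (sqrtC #|S|%:R)^-1 * \sum_(s : SS) L (w s) (a ((val s)^-1)%g x).
Proof.
rewrite /diamond linfunE ?ffunE // => c u v; apply/ffunP => y.
rewrite !ffunE scale_regE mulrCA -mulrDr; congr (_ * _).
rewrite mulr_sumr -big_split; apply: eq_bigr => s _.
by rewrite !ffunE linearP /= !ffunE.
Qed.

Lemma diamond_vec (L : 'Hom(W, _)) s w x :
  diamond S a L (ind_vec s w) x = (sqrtC #|S|%:R)^-1 * L w (a ((val s)^-1)%g x).
Proof.
rewrite diamondE; congr (_ * _); rewrite (bigD1 s) //= ffunE eqxx.
by rewrite big1 ?addr0 // => t /negbTE ts; rewrite ffunE ts linear0 ffunE.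
Qed.

(** In the resulting double sum over representatives s, t with t^-1 g s in [H]
the element t is determined by s, so the sum over t has a single term. *)
Lemma diamond_intertwiner L : L \in intertwiners H rho lambda ->
  diamond S a L \in intertwiners [set: gT] (ind_rep H S rho) lambda.
Proof.
move=> /intertwinersP LH; apply/intertwinersP => g _ w; apply/ffunP => x.
rewrite perm_repE !diamondE; congr (_ * _).
transitivity (\sum_(t : SS) \sum_(s : SS | ((val t)^-1 * g * val s)%g \in H)
    L (w s) (a ((val s)^-1 * g^-1)%g x)).
  apply: eq_bigr => t _; rewrite ind_repE linear_sum sum_ffunE.
  apply: eq_bigr => s sH; rewrite /= LH // perm_repE; congr (L _ _).
  by rewrite -aM -invMg !mulgA mulgV mul1g invMg.
rewrite (exchange_big_dep predT) //=; apply: eq_bigr => s _.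
have [t tH] := transversal_ex (g * val s).
rewrite (bigD1 t) /= -?mulgA // big1 ?addr0 ?aM // => r /andP[rH /eqP[]].
by rewrite -mulgA in rH; exact: transversal_uniq tH rH.
Qed.

Lemma diamond_linear (L M : 'Hom(W, {ffun X -> C^o})) c :
  diamond S a (c *: L + M) = c *: diamond S a L + diamond S a M.
Proof.
apply: ind_hom_eq => s w; apply/ffunP => x.
rewrite add_lfunE scale_lfunE !ffunE !diamond_vec add_lfunE scale_lfunE.
by rewrite !ffunE !scale_regE mulrDr mulrCA.
Qed.

Lemma card_transversal_sqrt_neq0 : sqrtC (#|S|%:R : C) != 0.
Proof. by rewrite sqrtC_eq0 pnatr_eq0 -lt0n (cardD1 1%g) S1. Qed.

Lemma diamond_inj : injective (@diamond C gT S W X a).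
Proof.
move=> L M LM; apply/lfunP => w; apply/ffunP => x.
have := congr1 (fun P : 'Hom(_, {ffun X -> C^o}) => P (ind_vec one w) x) LM.
rewrite !diamond_vec /= invg1 a1.
by apply: mulfI; rewrite invr_eq0 card_transversal_sqrt_neq0.
Qed.

(** An intertwiner on the induced space is determined by its restriction to
the block of 1, which is therefore, up to the scalar, its preimage. *)
Lemma diamond_surj P :
  P \in intertwiners [set: gT] (ind_rep H S rho) lambda ->
  exists2 L, L \in intertwiners H rho lambda & diamond S a L = P.
Proof.
move=> /intertwinersP PG.
pose L := (sqrtC #|S|%:R) *: (P \o linfun (ind_vec one))%VF.
have LE w : L w = sqrtC #|S|%:R *: P (ind_vec one w).
  by rewrite scale_lfunE comp_lfunE (linfunE (ind_vec_linear _)).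
exists L.
  apply/intertwinersP => h hH w; rewrite !LE linearZ /= -PG ?inE //.
  by rewrite (ind_rep_base (s := one)) /= invg1 mul1g.
apply: ind_hom_eq => s w; apply/ffunP => x.
rewrite diamond_vec LE ffunE scale_regE mulKf ?card_transversal_sqrt_neq0 //.
rewrite -perm_repE -PG ?inE // (ind_rep_base (s := s)) mulVg //.
by rewrite rho1.
Qed.

Variable dotW : W -> W -> C.
Hypothesis dotWP : hermitian_dot dotW.

Lemma ind_dot_hermitian : @hermitian_dot C (ind_space S W) (ind_dot dotW).
Proof.
split=> [c u v w | u v]; rewrite /ind_dot.
  rewrite mulr_sumr -big_split; apply: eq_bigr => s _.
  by rewrite !ffunE dotWP.1.
by rewrite conj_sum; apply: eq_bigr => s _; rewrite -(hdotC dotWP).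
Qed.

Lemma ind_frame (K : finType) (b : K -> W) : parseval_frame dotW b ->
  @parseval_frame C (ind_space S W) (ind_dot dotW) _
    (fun k : SS * K => ind_vec k.1 (b k.2)).
Proof.
move=> bP w; rewrite sum_pair [RHS]ind_vec_sum; apply: eq_bigr => s _.
rewrite -[in RHS](bP (w s)) -[RHS](linfunE (ind_vec_linear s)) linear_sum.
apply: eq_bigr => k _; rewrite linearZ /= (linfunE (ind_vec_linear s)).
congr (_ *: _); rewrite /ind_dot (bigD1 s) //= ffunE eqxx big1 ?addr0 //.
by move=> t /negbTE ts; rewrite ffunE ts (hdotr0 dotWP).
Qed.

(** The |S| blocks contribute equally, as translation by [s] is unitary on
L(X); this cancels the square of the scalar in the diamond. *)
Lemma diamond_frame_dot (K : finType) (b : K -> W) (L M : 'Hom(W, _)) :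
  \sum_(k : SS * K) fun_dot (diamond S a L (ind_vec k.1 (b k.2)))
                            (diamond S a M (ind_vec k.1 (b k.2)))
  = \sum_k fun_dot (L (b k)) (M (b k)).
Proof.
rewrite sum_pair /= exchange_big; apply: eq_bigr => k _ /=.
transitivity (\sum_(s : SS) (#|S|%:R)^-1 * fun_dot (L (b k)) (M (b k))).
  apply: eq_bigr => s _.
  have bij : bijective (a ((val s)^-1)%g).
    by apply: (Bijective (g := a (val s))) => x; rewrite -aM ?mulVg ?mulgV a1.
  rewrite -(fun_dot_comp (L (b k)) (M (b k)) bij) mulr_sumr.
  apply: eq_bigr => x _; rewrite !diamond_vec conjM mulrACA; congr (_ * _).
  have /conj_Creal -> : (sqrtC (#|S|%:R : C))^-1 \is Num.real.
    by rewrite realV ger0_real // sqrtC_ge0 ler0n.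
  by rewrite -invfM -expr2 sqrtCK.
rewrite sumr_const card_sig -mulrnAl -[_ *+ #|_|]mulr_natl.
rewrite (eq_card (_ : _ =i S)) //.
by rewrite mulfV ?mul1r // pnatr_eq0 -lt0n (cardD1 1%g) S1.
Qed.

End Induction.

(** * Group actions, transport between classes, averaging *)

Section Actions.

Lemma lactK (rT : finGroupType) (D : Type) (a : laction rT D) g :
  cancel (a g) (a (g^-1)%g).
Proof. by move=> x; rewrite -lactM mulVg lact1. Qed.

Lemma lactKV (rT : finGroupType) (D : Type) (a : laction rT D) g :
  cancel (a (g^-1)%g) (a g).
Proof. by move=> x; rewrite -lactM mulgV lact1. Qed.

Variables (fT gT : finGroupType) (X Y Z : finType).
Variables (aX : laction gT X) (aZ : laction gT Z) (aY : laction fT Y).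

Lemma wr_act1 w : wr_act aY aZ (1%g : wreath fT aX) w = w.
Proof.
case: w => phi z; congr (_, _); last exact: lact1.
by apply/ffunP => x; rewrite !ffunE /= invg1 !lact1.
Qed.

Lemma wr_actM (p q : wreath fT aX) w :
  wr_act aY aZ (p * q)%g w = wr_act aY aZ p (wr_act aY aZ q w).
Proof.
case: w => phi z; congr (_, _); last exact: lactM.
by apply/ffunP => x; rewrite !ffunE /= invMg !lactM.
Qed.

Lemma wr_actKV (p : wreath fT aX) w :
  wr_act aY aZ (p^-1)%g (wr_act aY aZ p w) = w.
Proof. by rewrite -wr_actM mulVg wr_act1. Qed.

Lemma wr_invE (p : wreath fT aX) :
  (p^-1)%g = ([ffun x => (p.1 (aX p.2 x))^-1%g], (p.2^-1)%g).
Proof. by []. Qed.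

End Actions.

Section Transport.
Variable n : nat.

Lemma transport_id (P : 'I_n -> Type) i (d v : P i) : transport d v = v.
Proof. by rewrite /transport; case: eqP => // e; rewrite eq_axiomK. Qed.

Lemma transport_linear (R : pzRingType) (V : 'I_n -> lmodType R) i j :
  linear (@transport n V i j 0).
Proof.
rewrite /transport => a u v; case: eqP => [e | _]; last by rewrite scaler0 addr0.
by case: _ / e.
Qed.

(** Moves an equation between indices, such as g^-1 (g x) = x, into the argument
of a dependent family. *)
Lemma transport_arg (X : Type) (cls : X -> 'I_n) (P : 'I_n -> Type)
    (f : forall x, P (cls x)) x y j (d : P j) :
  x = y -> transport d (f x) = transport d (f y).
Proof. by move->. Qed.

End Transport.

Lemma average_intertwiner (C : numClosedFieldType) (gT : finGroupType)
    (V W : vectType C) (rho : gT -> 'End(V)) (tau : gT -> 'End(W))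
    (R : 'Hom(V, W)) :
  (forall g h v, rho (g * h)%g v = rho g (rho h v)) ->
  (forall g h w, tau (g * h)%g w = tau g (tau h w)) ->
  \sum_g (tau (g^-1)%g \o R \o rho g)%VF \in intertwiners [set: gT] rho tau.
Proof.
move=> rhoM tauM; apply/intertwinersP => h _ v.
rewrite !sum_lfunE linear_sum (reindex_inj (mulIg (h^-1)%g)).
apply: eq_bigr => g _; rewrite !comp_lfunE /= -rhoM mulgKV.
by rewrite invMg invgK tauM.
Qed.

(** * The product maps T_j *)

Section ProductMaps.
Variables (C : numClosedFieldType) (fT : finGroupType) (X Y : finType).
Variables (aY : laction fT Y).
Variables (n : nat) (cls : X -> 'I_n) (V : 'I_n -> vectType C).
Variable sigma : forall i, fT -> 'End(V i).
Variable m : 'I_n -> nat.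
Variable T : forall i, (m i).-tuple 'Hom(V i, {ffun Y -> C^o}).

Local Notation J := (mult_index cls m).
Local Notation E := (fun x => V (cls x)).
Local Notation tensorE := {ffun tensor_index E -> C^o}.

Lemma tensor_T_pure (j : J) (v : forall x, E x) phi :
  tensor_T T j (pure_tensor v) phi = \prod_x tnth (T (cls x)) (j x) (v x) (phi x).
Proof.
rewrite /tensor_T (tensor_lift_pure
  (l := fun (phi : {ffun X -> Y}) x w =>
    tnth (T (cls x)) (j x) w (phi x))) ?ffunE //.
- by move=> psi x a u u'; rewrite linearP !ffunE.
- by move=> w psi; rewrite ffunE.
Qed.

Section Orthonormal.
Variable e : forall i, seq (V i).
Hypothesis oT : forall i (h k : 'I_(m i)),
  hs_dot (@fun_dot C Y) (e i) (tnth (T i) h) (tnth (T i) k) = (h == k)%:R.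

Local Notation eps := {dffun forall x, 'I_(size (e (cls x)))}.
Definition tensor_vec (k : eps) : tensorE :=
  pure_tensor (fun x => (e (cls x))`_(k x)).

Lemma fun_dot_prod (u v : forall x : X, {ffun Y -> C^o}) :
  fun_dot [ffun phi : {ffun X -> Y} => \prod_x u x (phi x)]
          [ffun phi : {ffun X -> Y} => \prod_x v x (phi x)]
  = \prod_x fun_dot (u x) (v x).
Proof.
rewrite /fun_dot (bigA_distr_bigA (fun x y => u x y * (v x y)^*)) /=.
by apply: eq_bigr => phi _; rewrite !ffunE conj_prod -big_split.
Qed.

Lemma tensor_T_orthonormal (j j' : J) :
  \sum_(k : eps)
    fun_dot (tensor_T T j (tensor_vec k)) (tensor_T T j' (tensor_vec k))
  = (j == j')%:R.
Proof.
have TE (i : J) (k : eps) : tensor_T T i (tensor_vec k) =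
    [ffun phi : {ffun X -> Y} =>
      \prod_x tnth (T (cls x)) (i x) (e (cls x))`_(k x) (phi x)].
  by apply/ffunP => phi; rewrite tensor_T_pure ffunE.
under eq_bigr => k _ do rewrite !TE fun_dot_prod.
rewrite -(prod_sum_dffun (fun x (k : 'I_(size (e (cls x)))) =>
  fun_dot (tnth (T (cls x)) (j x) (e (cls x))`_k)
          (tnth (T (cls x)) (j' x) (e (cls x))`_k))).
rewrite -ffun_natr_eq; apply: eq_bigr => x _.
by rewrite -oT /hs_dot (big_nth 0) big_mkord.
Qed.

(** The Hilbert-Schmidt product of [Q] and T_j. *)
Definition T_coef (Q : 'Hom(tensorE, {ffun {ffun X -> Y} -> C^o})) (j : J) : C :=
  \sum_(k : eps) fun_dot (Q (tensor_vec k)) (tensor_T T j (tensor_vec k)).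

Lemma T_coef_sum (c : J -> C) j :
  T_coef (\sum_i c i *: tensor_T T i) j = c j.
Proof.
rewrite /T_coef.
transitivity (\sum_i c i * (i == j)%:R).
  under [RHS]eq_bigr => i _ do rewrite -tensor_T_orthonormal mulr_sumr.
  rewrite [RHS]exchange_big.
  apply: eq_bigr => k _; rewrite sum_lfunE (hdot_suml (fun_dot_hermitian C _)).
  apply: eq_bigr => i _.
  by rewrite scale_lfunE (hdotZl (fun_dot_hermitian C _)).
rewrite (bigD1 j) //= eqxx mulr1 big1 ?addr0 // => i /negbTE ->.
by rewrite mulr0.
Qed.

Lemma tensor_T_free (c d : J -> C) :
  (forall v phi, \sum_j c j * tensor_T T j (pure_tensor v) phi
               = \sum_j d j * tensor_T T j (pure_tensor v) phi) -> c =1 d.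
Proof.
move=> cd j; rewrite -[LHS]T_coef_sum -[RHS]T_coef_sum; congr (T_coef _ _).
apply: tensor_hom_eq => v; apply/ffunP => phi; rewrite !sum_lfunE !sum_ffunE.
move: (cd v phi); under eq_bigr => i _ do rewrite -scale_regE.
under [X in _ = X]eq_bigr => i _ do rewrite -scale_regE.
move=> cdv; transitivity (\sum_i c i *: tensor_T T i (pure_tensor v) phi).
  by apply: eq_bigr => i _; rewrite scale_lfunE !ffunE.
by rewrite cdv; apply: eq_bigr => i _; rewrite scale_lfunE !ffunE.
Qed.

End Orthonormal.

Section Span.
Hypothesis sigmaM : forall i g h v,
  sigma i (g * h)%g v = sigma i g (sigma i h v).
Hypothesis TB : forall i,
  basis_of (intertwiners [set: fT] (sigma i) (perm_rep C aY)) (T i).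

(** The left-hand side is the average over [fT] of the rank one map
v |-> l(v) delta_y, up to the factor [#|fT|]; it is an intertwiner, hence a
combination of the [T i]. *)
Lemma averaged_rank_one i (l : 'Hom(V i, C^o)) (y : Y) :
  exists c : 'I_(m i) -> C, forall v y',
    \sum_g l (sigma i g v) * (y == aY g y')%:R
    = \sum_h c h * tnth (T i) h v y'.
Proof.
pose R : 'Hom(V i, {ffun Y -> C^o}) :=
  (linfun (fun c : C^o => c *: [ffun y' => (y == y')%:R] : {ffun Y -> C^o})
     \o l)%VF.
have RE v y' : R v y' = l v * (y == y')%:R.
  rewrite comp_lfunE linfunE ?ffunE ?scale_regE ?ffunE //.
  by move=> a u w; rewrite scalerDl scalerA.
have permM g h (f : {ffun Y -> C^o}) :
    perm_rep C aY (g * h)%g f = perm_rep C aY g (perm_rep C aY h f).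
  by apply/ffunP => z; rewrite !perm_repE invMg lactM.
have avR := average_intertwiner R (sigmaM (i := i)) permM.
exists (fun h =>
  coord (T i) h (\sum_g (perm_rep C aY (g^-1)%g \o R \o sigma i g)%VF)).
move=> v y'; move/(coord_basis (TB i)): avR.
move/(congr1 (fun Q : 'Hom(_, {ffun Y -> C^o}) => Q v y')).
rewrite !sum_lfunE !sum_ffunE => avE.
transitivity (\sum_g (perm_rep C aY (g^-1)%g \o R \o sigma i g)%VF v y').
  by apply: eq_bigr => g _; rewrite comp_lfunE comp_lfunE perm_repE invgK RE.
rewrite avE; apply: eq_bigr => h _.
by rewrite scale_lfunE ffunE -tnth_nth.
Qed.

(** The F^X-intertwiners are combinations of the product maps: [Q] equals its
average over F^X, and the average of each rank one product map in the
expansion of [Q] is a product of averages over F. *)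
Lemma tensor_T_span (Q : 'Hom(tensorE, {ffun {ffun X -> Y} -> C^o})) :
  (forall (f : {ffun X -> fT}) v (phi : {ffun X -> Y}),
     Q (pure_tensor (fun x => sigma (cls x) (f x) (v x)))
       [ffun x => aY (f x) (phi x)] = Q (pure_tensor v) phi) ->
  exists c : J -> C, Q = \sum_j c j *: tensor_T T j.
Proof.
move=> Qinv.
have [c cP] : exists c : forall (b : tensor_index E) (psi : {ffun X -> Y}) x,
    'I_(m (cls x)) -> C,
    forall (b : tensor_index E) (psi : {ffun X -> Y}) x v y',
    \sum_g coord (vbasis {:E x}) (b x) (sigma (cls x) g v) * (psi x == aY g y')%:R
    = \sum_h c b psi x h * tnth (T (cls x)) h v y'.
  have ex (b : tensor_index E) (psi : {ffun X -> Y}) x :=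
    averaged_rank_one (i := cls x)
      (linfun (coord (vbasis {:E x}) (b x) : E x -> C^o)) (psi x).
  exists (fun b psi x => projT1 (cid (ex b psi x))) => b psi x v y'.
  rewrite -(projT2 (cid (ex b psi x))); apply: eq_bigr => g _.
  by rewrite lfunE.
(* Both sides are multiplied by N, so that the average of Q becomes a sum. *)
pose N : C := #|{ffun X -> fT}|%:R.
have N0 : N != 0 by rewrite pnatr_eq0 -lt0n; apply/card_gt0P; exists [ffun=> 1%g].
exists (fun j : J => N^-1 * \sum_b \sum_psi Q (pure_tensor (tensor_vbasis b)) psi *
  \prod_x c b psi x (j x)).
apply: tensor_hom_eq => v; apply/ffunP => phi.
apply: (mulfI N0).
transitivity (\sum_(f : {ffun X -> fT})
    Q (pure_tensor (fun x => sigma (cls x) (f x) (v x)))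
      [ffun x => aY (f x) (phi x)]).
  by under eq_bigr => f _ do rewrite Qinv; rewrite sumr_const mulr_natl.
transitivity (\sum_(b : tensor_index E) \sum_(psi : {ffun X -> Y})
    Q (pure_tensor (tensor_vbasis b)) psi *
    \prod_x \sum_h c b psi x h * tnth (T (cls x)) h (v x) (phi x)).
  transitivity (\sum_(f : {ffun X -> fT}) \sum_(b : tensor_index E)
     \sum_(psi : {ffun X -> Y})
     Q (pure_tensor (tensor_vbasis b)) psi *
     \prod_x (coord (vbasis {:E x}) (b x) (sigma (cls x) (f x) (v x)) *
              (psi x == aY (f x) (phi x))%:R)).
    apply: eq_bigr => f _.
    rewrite [pure_tensor _]tensor_pure_sum linear_sum sum_ffunE.
    apply: eq_bigr => b _; rewrite linearZ /= !ffunE scale_regE.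
    (* The factors at psi vanish unless psi is the translate of phi by f. *)
    rewrite (bigD1 [ffun x => aY (f x) (phi x)]) //= big_split /=.
    rewrite [X in _ * (_ * X)]big1 ?mulr1; last first.
      by move=> x _; rewrite ffunE eqxx.
    rewrite [X in _ + X]big1 ?addr0 1?mulrC // => psi psif.
    rewrite big_split /= (_ : \prod_x (_ == _)%:R = 0) ?mulr0 //.
    transitivity (\prod_x ((psi x == [ffun x => aY (f x) (phi x)] x)%:R : C)).
      by apply: eq_bigr => x _; rewrite ffunE.
    by rewrite ffun_natr_eq (negbTE psif).
  (* The sum over f in F^X of a product is the product of sums over F. *)
  rewrite exchange_big; apply: eq_bigr => b _.
  rewrite exchange_big; apply: eq_bigr => psi _.
  rewrite -mulr_sumr; congr (_ * _).
  under [RHS]eq_bigr => x _ do rewrite -cP.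
  by rewrite bigA_distr_bigA.
rewrite sum_lfunE sum_ffunE mulr_sumr.
transitivity (\sum_(j : J) \sum_b \sum_psi Q (pure_tensor (tensor_vbasis b)) psi *
  \prod_x c b psi x (j x) * tensor_T T j (pure_tensor v) phi).
  rewrite [RHS]exchange_big; apply: eq_bigr => b _.
  rewrite [RHS]exchange_big; apply: eq_bigr => psi _.
  rewrite prod_sum_dffun mulr_sumr; apply: eq_bigr => j _.
  by rewrite tensor_T_pure big_split mulrA.
apply: eq_bigr => j _; rewrite scale_lfunE ffunE scale_regE mulrA mulrA mulfV //.
rewrite mul1r mulr_suml; apply: eq_bigr => b _.
by rewrite mulr_suml.
Qed.

End Span.
End ProductMaps.

(** * Coordinates of intertwiners in the basis T_j *)

Lemma pure2_pure_hom_eq (C : numClosedFieldType) (X : finType)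
    (E : X -> vectType C) (U W : vectType C)
    (f g : 'Hom({ffun tens2_index {ffun tensor_index E -> C^o} U -> C^o}, W)) :
  (forall v u, f (pure2 (pure_tensor v) u) = g (pure2 (pure_tensor v) u)) ->
  f = g.
Proof.
move=> fg; apply: tensor2_hom_eq => t u.
pose lin := linfunE (@pure2_linearl C {ffun tensor_index E -> C^o} U u).
suff eqfg :
    (f \o linfun ((@pure2 C _ U)^~ u) = g \o linfun ((@pure2 C _ U)^~ u))%VF.
  by have := congr1 (fun h : 'Hom(_, W) => h t) eqfg; rewrite !comp_lfunE !lin.
by apply: tensor_hom_eq => v; rewrite !comp_lfunE !lin.
Qed.

Section Hat.
Variables (C : numClosedFieldType) (fT gT : finGroupType) (X Y Z : finType).
Variables (aX : laction gT X) (aZ : laction gT Z) (aY : laction fT Y).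
Variables (n : nat) (cls : X -> 'I_n) (V : 'I_n -> vectType C).
Variable sigma : forall i, fT -> 'End(V i).
Variables (U : vectType C) (eta : gT -> 'End(U)).
Variable m : 'I_n -> nat.
Variable T : forall i, (m i).-tuple 'Hom(V i, {ffun Y -> C^o}).

Local Notation J := (mult_index cls m).
Local Notation E := (fun x => V (cls x)).
Local Notation tensorE := {ffun tensor_index E -> C^o}.
Local Notation I := (inertia aX cls sigma).
Local Notation H := (wr_sub fT aX I).

Lemma sigma_tilde_pure (p : wreath fT aX) (v : forall x, E x) :
  sigma_tilde cls sigma p (pure_tensor v) =
  pure_tensor (fun x => sigma (cls x) (p.1 x)
    (transport (P := V) 0 (v (aX (p.2^-1)%g x)))).
Proof.
pose l (b : tensor_index E) x (w : E x) := coord (vbasis {:E (aX p.2 x)})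
  (b (aX p.2 x)) (sigma _ (p.1 (aX p.2 x)) (transport (P := V) 0 w)).
rewrite /sigma_tilde; apply: (tensor_lift_pure (l := l)).
  by move=> b x a u w; rewrite /l transport_linear !linearP.
move=> w b; rewrite ffunE (reindex (aX p.2)); last first.
  apply: onW_bij; exact: (Bijective (lactK _ _) (lactKV _ _)).
apply: eq_bigr => x _; rewrite /l.
by rewrite (@transport_arg _ _ cls V w _ x _ 0) // lactK.
Qed.

Lemma wr_rep_pure2 (p : wreath fT aX) t u :
  wr_rep cls sigma eta p (pure2 t u) =
  pure2 (sigma_tilde cls sigma p t) (eta p.2 u).
Proof.
rewrite /wr_rep lift2_pure // => [b c s s' | a c s s'].
  by rewrite linearP pure2_linearl.
by rewrite linearP pure2_linearr.
Qed.

Lemma wr_rep1 t : (forall i v, sigma i 1%g v = v) -> (forall u, eta 1%g u = u) ->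
  wr_rep (aX := aX) cls sigma eta 1%g t = t.
Proof.
move=> sigma1 eta1; rewrite -[RHS]id_lfunE; congr (fun_of_lfun _ t).
apply: pure2_pure_hom_eq => v u.
rewrite id_lfunE wr_rep_pure2 eta1 sigma_tilde_pure; congr pure2.
congr pure_tensor; apply: functional_extensionality_dep => x /=.
rewrite ffunE sigma1 (@transport_arg _ _ cls V v _ x _ 0) ?transport_id //.
by rewrite invg1 lact1.
Qed.

Lemma hat_mapE (A : 'Hom(U, {ffun Z * J -> C^o})) t u w :
  hat_map T A (pure2 t u) w = \sum_j A u (w.2, j) * tensor_T T j t w.1.
Proof.
rewrite /hat_map lift2_pure ?ffunE // => [b c s s' | a c s s']; apply/ffunP => w';
  rewrite !ffunE scale_regE mulr_sumr -big_split; apply: eq_bigr => j _;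
  rewrite linearP !ffunE !scale_regE.
  by rewrite mulrDr mulrCA.
by rewrite mulrDl mulrA.
Qed.

Lemma hat_map_linear (A B : 'Hom(U, {ffun Z * J -> C^o})) c :
  hat_map T (c *: A + B) = c *: hat_map T A + hat_map T B.
Proof.
apply: tensor2_hom_eq => t u; apply/ffunP => w.
rewrite add_lfunE scale_lfunE !ffunE !hat_mapE scale_regE mulr_sumr -big_split.
apply: eq_bigr => j _; rewrite add_lfunE scale_lfunE !ffunE scale_regE.
by rewrite mulrDl mulrA.
Qed.

(** The action on J alone: [mult_act] is its product with the action on Z. *)
Definition mult_actJ (g : gT) (j : J) : J :=
  [ffun x => transport (P := fun i => 'I_(m i)) (j x) (j (aX (g^-1)%g x))].

Section Equivariance.
Hypothesis sigma_ineq : forall i j, i != j ->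
  ~ equivalent_rep [set: fT] (sigma i) (sigma j).
Hypothesis T_inter : forall i h,
  tnth (T i) h \in intertwiners [set: fT] (sigma i) (perm_rep C aY).

(** Inequivalence of the distinct sigma_i turns equivalence of sigma_(gx) and
sigma_x into equality of classes. *)
Lemma inertiaP g : reflect (forall x, cls (aX g x) = cls x) (g \in I).
Proof.
rewrite inE; apply: (iffP (asboolP _)) => [eqv x | clsg x].
  by apply/eqP; apply: contraT => /sigma_ineq; case/(_ (eqv x)).
rewrite clsg; exists \1%VF.
  by apply/intertwinersP => f _ v; rewrite !id_lfunE.
by exists id => v; rewrite id_lfunE.
Qed.

Lemma inertia1 : 1%g \in I.
Proof. by apply/inertiaP => x; rewrite lact1. Qed.

Lemma inertiaV g : g \in I -> (g^-1)%g \in I.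
Proof.
by move/inertiaP => gI; apply/inertiaP => x; rewrite -[in LHS]gI lactKV.
Qed.

Lemma wr_sub1 : 1%g \in H.
Proof. by rewrite inE; exact: inertia1. Qed.

Lemma mult_actJK g : g \in I -> cancel (mult_actJ g) (mult_actJ (g^-1)%g).
Proof.
move=> gI j; apply/ffunP => x; rewrite ffunE.
have clsg : cls (aX g x) = cls x by apply/inertiaP.
pose P i := 'I_(m i).
have e1 : aX (g^-1)^-1%g x = aX g x by rewrite invgK.
have e2 : aX (g^-1)%g (aX g x) = x by rewrite lactK.
rewrite (@transport_arg _ _ cls P (mult_actJ g j) _ _ _ _ e1).
move: (mult_actJ g j x) => d; rewrite ffunE.
rewrite (@transport_arg _ _ cls P j _ _ _ _ e2).
move: (j (aX g x)) (j x) d; rewrite clsg => d' k d.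
by rewrite !transport_id.
Qed.

Lemma tnth_T_transport i i' (h : 'I_(m i')) d (w : V i) : i = i' ->
  tnth (T i') h (transport (P := V) 0 w) =
  tnth (T i) (transport (P := fun i => 'I_(m i)) d h) w.
Proof. by move=> e; case: _ / e h => h; rewrite !transport_id. Qed.

(** This is where the inertia group acts on J: after the substitution x -> g x
the factor T_(gx, j(gx)) is applied to v_x, and it equals T_(x, j(gx)) because
the basis is the same throughout a class; f is moved to the other side of the
product by F-equivariance of the T_(x,h). *)
Lemma tensor_T_sigma_tilde (p : wreath fT aX) j v phi z : p \in H ->
  tensor_T T j (sigma_tilde cls sigma p (pure_tensor v)) phi =
  tensor_T T (mult_actJ (p.2^-1)%g j) (pure_tensor v)
    (wr_act aY aZ (p^-1)%g (phi, z)).1.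
Proof.
rewrite inE => /inertiaP pI; rewrite sigma_tilde_pure !tensor_T_pure wr_invE.
rewrite (reindex (aX p.2)); last first.
  apply: onW_bij; exact: (Bijective (lactK _ _) (lactKV _ _)).
apply: eq_bigr => x _; rewrite (@transport_arg _ _ cls V v _ x _ 0) ?lactK //.
have [/(_ _)] := intertwinersP [set: fT] (sigma (cls (aX p.2 x))) (perm_rep C aY)
  (tnth (T (cls (aX p.2 x))) (j (aX p.2 x))).
move=> /(_ (T_inter _)) TH _; rewrite TH ?inE // perm_repE !ffunE /= !invgK.
by rewrite -(tnth_T_transport _ _ _ (esym (pI x))).
Qed.

Lemma perm_rep_mult g (F : {ffun Z * J -> C^o}) z j :
  perm_rep C (mult_act aX aZ (m := m)) g F (z, j) =
  F (aZ (g^-1)%g z, mult_actJ (g^-1)%g j).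
Proof. by rewrite perm_repE. Qed.

Lemma hat_map_sigma_tilde A (p : wreath fT aX) v u phi z : p \in H ->
  hat_map T A (wr_rep cls sigma eta p (pure2 (pure_tensor v) u)) (phi, z) =
  \sum_j A (eta p.2 u) (z, mult_actJ p.2 j) *
    tensor_T T j (pure_tensor v) (wr_act aY aZ (p^-1)%g (phi, z)).1.
Proof.
move=> pH; have pI : p.2 \in I by rewrite inE in pH.
rewrite wr_rep_pure2 hat_mapE /= (reindex (mult_actJ p.2)); last first.
  apply: onW_bij; apply: (Bijective (mult_actJK pI)).
  by have := mult_actJK (inertiaV pI); rewrite invgK.
apply: eq_bigr => j _; rewrite (tensor_T_sigma_tilde _ _ _ z pH).
by rewrite mult_actJK.
Qed.

Lemma hat_map_intertwiner A :
  A \in intertwiners I eta (perm_rep C (mult_act aX aZ (m := m))) ->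
  hat_map T A \in
    intertwiners H (wr_rep cls sigma eta) (perm_rep C (wr_act aY aZ)).
Proof.
move=> /intertwinersP AI; apply/intertwinersP => p pH t.
have pI : p.2 \in I by rewrite inE in pH.
rewrite -!comp_lfunE; congr (fun_of_lfun _ t).
apply: pure2_pure_hom_eq => v u; rewrite !comp_lfunE.
apply/ffunP => -[phi z]; rewrite hat_map_sigma_tilde // perm_repE hat_mapE.
by apply: eq_bigr => j _; rewrite AI // perm_rep_mult mult_actJK.
Qed.

End Equivariance.

Section Bijection.
Hypothesis sigmaM : forall i g h v,
  sigma i (g * h)%g v = sigma i g (sigma i h v).
Hypothesis sigma_ineq : forall i j, i != j ->
  ~ equivalent_rep [set: fT] (sigma i) (sigma j).
Hypothesis eta1 : forall u, eta 1%g u = u.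
Hypothesis TB : forall i,
  basis_of (intertwiners [set: fT] (sigma i) (perm_rep C aY)) (T i).
Variable e : forall i, seq (V i).
Hypothesis oT : forall i (h k : 'I_(m i)),
  hs_dot (@fun_dot C Y) (e i) (tnth (T i) h) (tnth (T i) k) = (h == k)%:R.

(** The T_j are linearly independent. *)
Lemma hat_map_inj : injective (@hat_map C X Y Z n cls V m T U).
Proof.
move=> A B AB; apply/lfunP => u; apply/ffunP => -[z j].
apply: (tensor_T_free oT (c := fun j => A u (z, j)) (d := fun j => B u (z, j))).
by move=> v phi; rewrite -!(hat_mapE _ _ _ (phi, z)) AB.
Qed.

Let T_inter i h :
  tnth (T i) h \in intertwiners [set: fT] (sigma i) (perm_rep C aY).
Proof. exact: basis_mem (TB i) (mem_tnth _ _). Qed.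

Lemma T_coef_linear (Q R : 'Hom(tensorE, {ffun {ffun X -> Y} -> C^o})) c j :
  T_coef T e (c *: Q + R) j = c * T_coef T e Q j + T_coef T e R j.
Proof.
rewrite /T_coef mulr_sumr -big_split; apply: eq_bigr => k _.
by rewrite add_lfunE scale_lfunE (fun_dot_hermitian C _).1.
Qed.

(** An F^X-intertwiner whenever [L] is an intertwiner for F wr I; its coordinates
in the basis T_j will be the values at [u] of the preimage of [L]. *)
Definition hom_slice (L : 'Hom({ffun tens2_index tensorE U -> C^o},
    {ffun {ffun X -> Y} * Z -> C^o})) (u : U) (z : Z) :
    'Hom(tensorE, {ffun {ffun X -> Y} -> C^o}) :=
  linfun (fun t =>
    [ffun phi => L (pure2 t u) (phi, z)] : {ffun {ffun X -> Y} -> C^o}).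

Lemma hom_sliceE L u z t phi : hom_slice L u z t phi = L (pure2 t u) (phi, z).
Proof.
rewrite /hom_slice linfunE ?ffunE // => c s s'; apply/ffunP => psi.
by rewrite !ffunE pure2_linearl linearP !ffunE.
Qed.

(** The preimage consists of the coordinates of the slices of [L] in the basis
T_j. It intertwines the actions of I since [L] intertwines those of F wr I:
both values of it that are to be compared are coordinates of one slice. *)
Lemma hat_map_surj L :
  L \in intertwiners H (wr_rep cls sigma eta) (perm_rep C (wr_act aY aZ)) ->
  exists2 A, A \in intertwiners I eta (perm_rep C (mult_act aX aZ (m := m)))
           & hat_map T A = L.
Proof.
move=> /intertwinersP LH.
pose A : 'Hom(U, {ffun Z * J -> C^o}) := linfun (fun u =>
  [ffun w => T_coef T e (hom_slice L u w.1) w.2] : {ffun Z * J -> C^o}).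
have AE u z j : A u (z, j) = T_coef T e (hom_slice L u z) j.
  rewrite /A linfunE ?ffunE // => c s s'; apply/ffunP => w; rewrite !ffunE.
  rewrite scale_regE -T_coef_linear; congr (T_coef _ _ _ _).
  apply/lfunP => t; apply/ffunP => phi; rewrite add_lfunE scale_lfunE !ffunE.
  by rewrite !hom_sliceE pure2_linearr linearP !ffunE.
have LA : hat_map T A = L.
  apply: pure2_pure_hom_eq => v u; apply/ffunP => -[phi z].
  rewrite hat_mapE /= -hom_sliceE.
  have [c cE] : exists c : J -> C, hom_slice L u z = \sum_j c j *: tensor_T T j.
    apply: (tensor_T_span sigmaM TB) => f w psi; rewrite !hom_sliceE.
    (* (f, 1) fixes both z and u, so the slice is an F^X-intertwiner. *)
    pose p : wreath fT aX := (f, 1%g).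
    have pH : p \in H by rewrite inE; exact: inertia1.
    have := congr1 (fun F : {ffun {ffun X -> Y} * Z -> C^o} =>
      F (wr_act aY aZ p (psi, z))) (LH p pH (pure2 (pure_tensor w) u)).
    rewrite perm_repE wr_actKV wr_rep_pure2 /= eta1 => <-.
    rewrite sigma_tilde_pure /wr_act /= lact1.
    congr (L (pure2 _ _) (_, _)).
      congr pure_tensor; apply: functional_extensionality_dep => x.
      rewrite (@transport_arg _ _ cls V w _ x _ 0) ?transport_id //.
      by rewrite invg1 lact1.
    by apply/ffunP => x; rewrite !ffunE invg1 lact1.
  rewrite cE sum_lfunE sum_ffunE; apply: eq_bigr => j _.
  by rewrite AE cE (T_coef_sum oT) scale_lfunE ffunE.
exists A => //; apply/intertwinersP => g gI u; apply/ffunP => -[z j].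
rewrite perm_rep_mult; pose p : wreath fT aX := ([ffun=> 1%g], g).
have pH : p \in H by rewrite inE.
rewrite -[j in LHS](_ : mult_actJ g (mult_actJ (g^-1)%g j) = j); last first.
  by have := mult_actJK sigma_ineq (inertiaV sigma_ineq gI); rewrite invgK; exact.
(* It suffices to compare coordinates, after translation of j by g. *)
apply: (tensor_T_free oT (c := fun j => A (eta g u) (z, mult_actJ g j))
  (d := fun j => A u (aZ (g^-1)%g z, j))) => v phi.
pose w := wr_act aY aZ p (phi, aZ (g^-1)%g z).
have wE : w = (w.1, z) by rewrite [LHS]surjective_pairing /= lactKV.
have := congr1 (fun F : {ffun {ffun X -> Y} * Z -> C^o} => F w)
  (LH p pH (pure2 (pure_tensor v) u)).
rewrite -LA perm_repE wr_actKV hat_mapE /= => <-.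
by rewrite wE (hat_map_sigma_tilde sigma_ineq T_inter) // -wE wr_actKV.
Qed.

(** Summing over the tensor frame first replaces <T_j, T_j'> by the Kronecker
delta, leaving the inner product of L(Z x J). *)
Lemma hat_map_frame_dot (K : finType) (b : K -> U)
    (A B : 'Hom(U, {ffun Z * J -> C^o})) :
  \sum_(k : {dffun forall x, 'I_(size (e (cls x)))} * K)
    fun_dot (hat_map T A (pure2 (tensor_vec k.1) (b k.2)))
            (hat_map T B (pure2 (tensor_vec k.1) (b k.2)))
  = \sum_k fun_dot (A (b k)) (B (b k)).
Proof.
rewrite sum_pair exchange_big; apply: eq_bigr => l _ /=.
transitivity (\sum_(k : {dffun forall x, 'I_(size (e (cls x)))})
  \sum_z \sum_j \sum_j' A (b l) (z, j) * (B (b l) (z, j'))^* *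
    fun_dot (tensor_T T j (tensor_vec k)) (tensor_T T j' (tensor_vec k))).
  apply: eq_bigr => k _; rewrite /fun_dot sum_pair exchange_big.
  apply: eq_bigr => z _ /=.
  transitivity (\sum_phi \sum_j \sum_j' A (b l) (z, j) * (B (b l) (z, j'))^* *
    (tensor_T T j (tensor_vec k) phi * (tensor_T T j' (tensor_vec k) phi)^*)).
    apply: eq_bigr => phi _; rewrite !hat_mapE conj_sum big_distrlr /=.
    by apply: eq_bigr => j _; apply: eq_bigr => j' _; rewrite conjM mulrACA.
  rewrite exchange_big; apply: eq_bigr => j _.
  rewrite exchange_big; apply: eq_bigr => j' _.
  by rewrite mulr_sumr.
rewrite /fun_dot sum_pair exchange_big; apply: eq_bigr => z _.
rewrite exchange_big; apply: eq_bigr => j _.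
rewrite exchange_big (bigD1 j) //= -mulr_sumr (tensor_T_orthonormal oT) eqxx mulr1.
rewrite big1 ?addr0 // => j' /negbTE jj'.
by rewrite -mulr_sumr (tensor_T_orthonormal oT) eq_sym jj' mulr0.
Qed.

End Bijection.
End Hat.

(** * The isometric isomorphism *)

Theorem theorem5p8 (C : numClosedFieldType) (fT gT : finGroupType)
    (X Y Z : finType)
    (aX : laction gT X) (aZ : laction gT Z) (aY : laction fT Y)
    (trX : ltransitive aX) (trZ : ltransitive aZ) (trY : ltransitive aY)
    (n : nat) (cls : X -> 'I_n) (clsP : forall i, exists x, cls x = i)
    (V : 'I_n -> vectType C) (dotV : forall i, {dot V i for Num.conj})
    (sigma : forall i, fT -> 'End(V i))
    (sigma_unitary : forall i, unitary_rep [set: fT] (dotV i) (sigma i))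
    (sigma_irr : forall i, irreducible_rep [set: fT] (sigma i))
    (sigma_ineq : forall i j, i != j ->
       ~ equivalent_rep [set: fT] (sigma i) (sigma j))
    (sigma_occ : forall x, occurs_in [set: fT] (sigma (cls x)) (perm_rep C aY))
    (U : vectType C) (dotU : {dot U for Num.conj}) (eta : gT -> 'End(U))
    (eta_unitary : unitary_rep (inertia aX cls sigma) dotU eta)
    (eta_irr : irreducible_rep (inertia aX cls sigma) eta)
    (eV : forall i, seq (V i))
    (eVP : forall i, orthonormal_basis (dotV i) fullv (eV i))
    (m : 'I_n -> nat)
    (T : forall i, (m i).-tuple 'Hom(V i, {ffun Y -> C^o}))
    (TP : forall i, orthonormal_basis (hs_dot (@fun_dot C Y) (eV i))
       (intertwiners [set: fT] (sigma i) (perm_rep C aY)) (T i))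
    (S : {set wreath fT aX}) (S1 : 1%g \in S)
    (ST : left_transversal (wr_sub fT aX (inertia aX cls sigma)) S) :
  let I := inertia aX cls sigma in
  let HomI := intertwiners I eta (perm_rep C (mult_act aX aZ (m := m))) in
  let HomFG := intertwiners [set: wreath fT aX]
    (ind_rep (wr_sub fT aX I) S (wr_rep cls sigma eta))
    (perm_rep C (wr_act aY aZ)) in
  let dotInd := ind_dot (dot2 (tensor_dot (fun x => dotV (cls x))) dotU) in
  let Phi := fun A : 'Hom(U, {ffun Z * mult_index cls m -> C^o}) =>
    diamond S (wr_act aY aZ) (hat_map T A) in
  [/\ {in HomI &, forall A B, forall c : C, Phi (c *: A + B) = c *: Phi A + Phi B},
      set_bij [set` HomI] [set` HomFG] Phi
    & forall (eU : seq U) (eInd : seq (ind_space S _)),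
        orthonormal_basis dotU fullv eU ->
        orthonormal_basis dotInd fullv eInd ->
        {in HomI &, forall A B,
          hs_dot (@fun_dot C _) eInd (Phi A) (Phi B) =
          hs_dot (@fun_dot C _) eU A B}].
Proof.
move=> I HomI HomFG dotInd Phi.
have sigma1 i v : sigma i 1%g v = v by case: (sigma_unitary i).
have sigmaM i g h v : sigma i (g * h)%g v = sigma i g (sigma i h v).
  by have [_ sM _] := sigma_unitary i; rewrite sM ?inE.
have eta1 u : eta 1%g u = u by case: eta_unitary.
have TB i : basis_of (intertwiners [set: fT] (sigma i) (perm_rep C aY)) (T i).
  by case: (TP i).
have oT i (h k : 'I_(m i)) :
    hs_dot (@fun_dot C Y) (eV i) (tnth (T i) h) (tnth (T i) k) = (h == k)%:R.
  have [_ oTi] := TP i.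
  have sz := size_tuple (T i).
  have := oTi (cast_ord (esym sz) h) (cast_ord (esym sz) k).
  by rewrite !(tnth_nth 0) /= => ->.
have T_inter i h :
    tnth (T i) h \in intertwiners [set: fT] (sigma i) (perm_rep C aY).
  exact: basis_mem (TB i) (mem_tnth _ _).
have H1 : 1%g \in wr_sub fT aX I by exact: wr_sub1.
have rho1 w : wr_rep (aX := aX) cls sigma eta 1%g w = w by exact: wr_rep1.
have a1 w : wr_act aY aZ (1%g : wreath fT aX) w = w by exact: wr_act1.
have aM (p q : wreath fT aX) w :
    wr_act aY aZ (p * q)%g w = wr_act aY aZ p (wr_act aY aZ q w).
  exact: wr_actM.
split.
- by move=> A B _ _ c; rewrite /Phi hat_map_linear diamond_linear.
- split.
  + move=> A /= AI; apply: diamond_intertwiner => //.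
    exact: hat_map_intertwiner.
  + move=> A B _ _ /(diamond_inj S1 a1); exact: (hat_map_inj oT).
  + move=> P /= /(diamond_surj H1 S1 ST rho1)[L LH <-].
    have [A AI <-] := hat_map_surj sigmaM sigma_ineq eta1 TB oT LH.
    by exists A.
move=> eU eInd eUP eIndP A B _ _.
have hV x : hermitian_dot (dotV (cls x)) by exact: dot_hermitian.
have hU := dot_hermitian dotU.
have hT := tensor_dot_hermitian hV.
have fU := orthonormal_basis_frame hU eUP.
have fV x := orthonormal_basis_frame (hV x) (eVP (cls x)).
have fT' := tensor_frame hV fV.
have fW := frame2 hT hU fT' fU.
have h2 := dot2_hermitian hT hU.
rewrite (hs_dot_frame _ _ (ind_dot_hermitian S h2) (fun_dot_hermitian C _) eIndP
  (ind_frame h2 fW)).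
rewrite (hs_dot_frame _ _ hU (fun_dot_hermitian C _) eUP fU).
rewrite -(hat_map_frame_dot oT (fun k : 'I_(size eU) => eU`_k)).
exact: (diamond_frame_dot S1 a1 aM).
Qed.
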